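(* Suppose $\mathrm{char}(\mathbb{F}_q)\neq2$. Let $V=\mathrm{Sym}^2(\mathbb{F}_q^3)$ be the space of ternary quadratic forms with the action of $G=\mathrm{GL}_1(\mathbb{F}_q)\times\mathrm{GL}_3(\mathbb{F}_q)$, with $G$-orbits $\mathcal{O}_1,\dots,\mathcal{O}_5$ having the representatives $0$, $u^2$, $uv$, $u^2-lv^2$, $u^2-vw$ respectively ($l\in\mathbb{F}_q^\times$ a non-square), and let $e_i$ be the indicator function of $\mathcal{O}_i$. Let $M=[a_{ij}]$ be the matrix defined by $\widehat{e_j}=\sum_i a_{ij}e_i$. Then $$M=\frac1{q^6}\begin{bmatrix} 1&q^3-1&q(q+1)(q^3-1)/2&q(q-1)(q^3-1)/2&q^2(q-1)(q^3-1)\\ 1&-1&q(q+1)(q^2-1)/2&-q(q-1)(q^2+1)/2&-q^2(q-1)\\ 1&q^2-1&q(q^2-2q-1)/2&q(q-1)^2/2&-q^2(q-1)\\ 1&-q^2-1&q(q^2-1)/2&q(q^2+1)/2&-q^2(q-1)\\ 1&-1&-q(q+1)/2&-q(q-1)/2&q^2 \end{bmatrix}.$$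
   Context: $p=\mathrm{char}(\mathbb{F}_q)\neq2$. Elements of $V$ are ternary quadratic forms $x(u,v,w)=au^2+buv+cuw+dv^2+evw+fw^2=(a,b,c,d,e,f)$, and $(g_1,g_3)\in G$ acts by $((g_1,g_3)\cdot x)(u,v,w)=g_1\,x((u,v,w)g_3)$. The five orbits listed are distinct and exhaust $V$. The bilinear form is $[x,x']=aa'+bb'/2+cc'/2+dd'+ee'/2+ff'$, and for $\phi\colon V\to\mathbb{C}$ the Fourier transform is $$\widehat\phi(y)=q^{-6}\sum_{x\in V}\phi(x)\exp\left(2\pi\sqrt{-1}\cdot\mathrm{Tr}_{\mathbb{F}_q/\mathbb{F}_p}([x,y])/p\right).$$ *)

(* Defs.v *)
From HB Require Import structures.
From mathcomp Require Import all_boot all_order all_algebra all_fingroup all_field.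
From mathcomp Require Import complex ring.
From mathcomp Require Import reals trigo.

Set Implicit Arguments.
Unset Strict Implicit.
Unset Printing Implicit Defensive.

Import Order.TTheory GRing.Theory Num.Theory.

Local Open Scope ring_scope.
Local Open Scope complex_scope.

Section TernaryForms.
Variable F : finFieldType.

(* The form a u^2 + b uv + c uw + d v^2 + e vw + f w^2 is encoded by the row   *)
(* (a, b, c, d, e, f).                                                         *)
Definition qform (a b c d e f : F) : 'rV[F]_6 :=
  \row_(i < 6) [:: a; b; c; d; e; f]`_i.

Definition qeval (x : 'rV[F]_6) (v : 'rV[F]_3) : F :=
  x 0 (inord 0) * v 0 (inord 0) ^+ 2
  + x 0 (inord 1) * (v 0 (inord 0) * v 0 (inord 1))
  + x 0 (inord 2) * (v 0 (inord 0) * v 0 (inord 2))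
  + x 0 (inord 3) * v 0 (inord 1) ^+ 2
  + x 0 (inord 4) * (v 0 (inord 1) * v 0 (inord 2))
  + x 0 (inord 5) * v 0 (inord 2) ^+ 2.

(* Reads off by polarization the coefficients of a quadratic form from the     *)
(* function that it defines: the coefficient of the square of the k-th         *)
(* variable is the value at the k-th basis vector, and the one of the product  *)
(* of two variables is a value of the polar form.                              *)
Definition qform_of (Q : 'rV[F]_3 -> F) : 'rV[F]_6 :=
  let E k : 'rV[F]_3 := delta_mx 0 (inord k) in
  let B j k := Q (E j + E k) - Q (E j) - Q (E k) in
  qform (Q (E 0%N)) (B 0%N 1%N) (B 0%N 2%N) (Q (E 1%N)) (B 1%N 2%N) (Q (E 2%N)).

(* ((g1, g3) . x)(v) = g1 x(v g3), as established in qeval_qact. This is a     *)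
(* left action, whence the direct definition of orbits below: the actions of   *)
(* action.v are right actions.                                                 *)
Definition qact (g : {unit F} * {'GL_3[F]}) (x : 'rV[F]_6) : 'rV[F]_6 :=
  qform_of (fun v => val g.1 * qeval x (v *m GLval g.2)).

Definition qorbit (x : 'rV[F]_6) : {set 'rV[F]_6} :=
  [set qact g x | g : {unit F} * {'GL_3[F]}].

Definition qbil (x y : 'rV[F]_6) : F :=
  x 0 (inord 0) * y 0 (inord 0)
  + x 0 (inord 1) * y 0 (inord 1) / 2%:R
  + x 0 (inord 2) * y 0 (inord 2) / 2%:R
  + x 0 (inord 3) * y 0 (inord 3)
  + x 0 (inord 4) * y 0 (inord 4) / 2%:R
  + x 0 (inord 5) * y 0 (inord 5).

(* In order: 0, u^2, uv, u^2 - l v^2, u^2 - vw.                                *)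
Definition orbit_rep (l : F) (i : 'I_5) : 'rV[F]_6 :=
  [:: 0; qform 1 0 0 0 0 0; qform 0 1 0 0 0 0; qform 1 0 0 (- l) 0 0;
      qform 1 0 0 0 (- 1) 0]`_i.

Lemma qformE a b c d e f k : (k < 6)%N ->
  qform a b c d e f 0 (inord k) = [:: a; b; c; d; e; f]`_k.
Proof. by move=> lt_k6; rewrite mxE inordK. Qed.

Lemma qform_eta (x : 'rV[F]_6) :
  qform (x 0 (inord 0)) (x 0 (inord 1)) (x 0 (inord 2))
        (x 0 (inord 3)) (x 0 (inord 4)) (x 0 (inord 5)) = x.
Proof.
apply/rowP=> i; rewrite mxE -[i in RHS]inord_val.
by case: i; do 6?[case=> [|] //=].
Qed.

Lemma qevalK (x : 'rV[F]_6) : qform_of (qeval x) = x.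
Proof.
have ne j k : (j < 3)%N -> (k < 3)%N ->
    (delta_mx 0 (inord j) : 'rV[F]_3) 0 (inord k) = (k == j)%:R.
  by move=> ltj ltk; rewrite mxE eqxx -val_eqE /= !inordK.
have De (v w : 'rV[F]_3) k : (v + w) 0 k = v 0 k + w 0 k by rewrite mxE.
rewrite -[RHS]qform_eta /qform_of /qeval !De !ne //=.
by congr qform; ring.
Qed.

Lemma qeval_qact g (x : 'rV[F]_6) v :
  qeval (qact g x) v = val g.1 * qeval x (v *m GLval g.2).
Proof.
case: g => g1 g3 /=; set A : 'M[F]_3 := GLval g3; set t : F := val g1.
have vA k : (v *m A) 0 k = v 0 (inord 0) * A (inord 0) k
    + v 0 (inord 1) * A (inord 1) k + v 0 (inord 2) * A (inord 2) k.
  rewrite mxE 3!big_ord_recl big_ord0 addr0 addrA.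
  by congr (v 0 _ * A _ k + v 0 _ * A _ k + v 0 _ * A _ k);
     apply: val_inj; rewrite /= inordK.
have EA j k : ((delta_mx 0 j : 'rV[F]_3) *m A) 0 k = A j k.
  by rewrite -rowE mxE.
have De (u w : 'rV[F]_3) k : (u + w) 0 k = u 0 k + w 0 k by rewrite mxE.
rewrite {1}/qeval /qact /qform_of !qformE //= /= !mulmxDl /qeval.
rewrite !De !EA !vA -/t.
move: (v 0 (inord 0)) (v 0 (inord 1)) (v 0 (inord 2)) => v0 v1 v2.
move: (x 0 (inord 0)) (x 0 (inord 1)) (x 0 (inord 2)) => x0 x1 x2.
move: (x 0 (inord 3)) (x 0 (inord 4)) (x 0 (inord 5)) => x3 x4 x5.
move: (A (inord 0) (inord 0)) (A (inord 0) (inord 1)) (A (inord 0) (inord 2)).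
move: (A (inord 1) (inord 0)) (A (inord 1) (inord 1)) (A (inord 1) (inord 2)).
move: (A (inord 2) (inord 0)) (A (inord 2) (inord 1)) (A (inord 2) (inord 2)).
move: t; clear => *; ring.
Qed.

End TernaryForms.

Section FourierTransform.
Variables (R : realType) (F : finFieldType) (p : nat).
Hypothesis charFp : p \in [pchar F].

(* Tr_{F/F_p}: the library trace takes its values in F (which pPrimeCharType   *)
(* equips with its structure of extension of 'F_p); FpTr is the corresponding  *)
(* element of 'F_p, see FpTrE.                                                 *)
Definition FpTr (a : F) : 'F_p :=
  let L : splittingFieldType 'F_p := pPrimeCharType charFp in
  odflt 0 [pick t : 'F_p | t%:A == galTrace 1%VS {:L} (a : L)].

Lemma FpTrE (a : pPrimeCharType charFp) :
  (FpTr a)%:A = galTrace 1%VS {:pPrimeCharType charFp} a.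
Proof.
rewrite /FpTr; case: pickP => [t /eqP // | no_t].
pose L : splittingFieldType 'F_p := pPrimeCharType charFp.
have gal1 : galois 1%AS {:L} by apply: finField_galois; apply: sub1v.
have /vlineP[t Dt] : galTrace 1%AS {:L} (a : L) \in 1%VS.
  exact: mem_galTrace gal1 (memvf _).
by have := no_t t; rewrite -Dt eqxx.
Qed.

(* exp(sqrt(-1) theta), for theta real.                                        *)
Definition expi (theta : R) : R[i] := cos theta +i* sin theta.

(* An element of 'F_p is identified with its representative in [0, p).         *)
Definition fourier (phi : 'rV[F]_6 -> R[i]) (y : 'rV[F]_6) : R[i] :=
  #|F|%:R ^- 6 *
  \sum_(x : 'rV[F]_6) phi x * expi (2%:R * pi * (FpTr (qbil x y))%:R / p%:R).

Definition orbit_ind (l : F) (i : 'I_5) (x : 'rV[F]_6) : R[i] :=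
  (x \in qorbit (orbit_rep l i))%:R.

End FourierTransform.

(* Main.v *)
Require Import Defs.
From mathcomp Require Import all_boot all_order all_algebra all_fingroup all_field.
From mathcomp Require Import complex ring lra.
From mathcomp Require Import reals trigo.

Set Implicit Arguments.
Unset Strict Implicit.
Unset Printing Implicit Defensive.

Import Order.TTheory GRing.Theory Num.Theory.

(* The action on forms has to take precedence over the quotient action, which  *)
(* is also called qact.                                                        *)
Import Defs.

Local Open Scope ring_scope.
Local Open Scope complex_scope.

(** Let $\psi$ be the additive character of $F$ that defines the Fourier
    transform, and let $E_j(y)$ be the sum of $\psi([x, y])$ over the orbit $j$,
    so that the transform of its indicator is $q^{-6} E_j$. The sums $E_j$ are
    found without a count of any orbit or stabilizer, by solving linear
    equations.

    The product $LM$ of two linear forms satisfies $[LM, y] = B_y(L, M)$, where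
    $B_y$ is the symmetric bilinear form such that $B_y(L, L) = y(L)$
    (qbil_lprod_sq, qbil_lprod). Consider four functions of a form: the number
    $N(y)$ of its zeros, the cardinality $R(y)$ of its radical, the number
    $D(x)$ of pairs with $LM = x$, and the number $S(x)$ of pairs with
    $tL^2 = x$. Each is constant on orbits, so that the sum of
    $f(x) \psi([x, y])$ over all $x$ is $\sum_j f(j) E_j(y)$ when $f$ is one of
    them. On the other hand, summing over pairs instead of products and
    applying the orthogonality of characters gives
    - $q N(y)$ for $f = S$, by summation over $t$;
    - $q^3 R(y)$ for $f = D$, by summation over $M$;
    - $q^3 D(-y) = q^3 D(y)$ for $f = R$, by inversion of the previous transform;
    - $q^6$ or $0$ for $f = 1$, according to whether $y = 0$.
    With $E_1 = 1$ these four equations determine every $E_j(y)$, since $S$, $D$,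
    $R$ and $1$ take the following values on the five orbits:
    - $S$: $q^3 + q - 1$, $q - 1$, $0$, $0$, $0$;
    - $D$: $2q^3 - 1$, $q - 1$, $2(q - 1)$, $0$, $0$;
    - $R$: $q^3$, $q^2$, $q$, $q$, $1$.
    The right-hand sides only need, in addition, the values of $N$, which are
    $q^3$, $q^2$, $2q^2 - q$, $q$, $q^2$.

    It remains to see that the orbits partition the space. They are disjoint
    because the pair $(R, N)$ separates the representatives. They are exhaustive
    by completion of squares (qorbit_exhaust): a form is brought to
    $u^2 + dv^2 + fw^2$, or at once to $u^2 - vw$, and then the facts needed are that a nonsquare is a
    square times $l$ and that $ds^2 + ft^2 = -1$ has a solution, which follow
    from more than half of the elements of $F$ being squares (card_squares). *)

(** * The additive character *)

Section AdditiveCharacter.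
Variables (R : realType) (F : finFieldType) (p : nat).
Hypothesis charFp : p \in [pchar F].

Definition addchar (a : F) : R[i] :=
  expi (2%:R * pi * (FpTr charFp a)%:R / p%:R).

Lemma expiD (s t : R) : expi (s + t) = expi s * expi t.
Proof. by apply/eqP; rewrite eq_complex /= cosD sinD addrC eqxx addrC eqxx. Qed.

Lemma expi_2pi_nat n : expi (2%:R * pi * n%:R : R) = 1.
Proof.
elim: n => [|n IHn]; first by rewrite mulr0 /expi cos0 sin0.
rewrite -[n.+1]addn1 (natrD _ n) mulrDr expiD {}IHn mul1r mulr1 mulr_natl.
by rewrite /expi cos2pi sin2pi.
Qed.

(** The angle is in $(0, 2\pi)$, where half of it has a positive sine, so that
    the cosine is less than 1. *)
Lemma expi_root_neq1 k n : (0 < k < n)%N ->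
  expi (2%:R * pi * k%:R / n%:R : R) != 1.
Proof.
move=> /andP[k_gt0 lt_kn].
have n_gt0 : 0 < n%:R :> R by rewrite ltr0n (leq_trans _ lt_kn).
set h : R := pi * k%:R / n%:R.
have -> : 2%:R * pi * k%:R / n%:R = h *+ 2 by rewrite -[RHS]mulr_natl /h !mulrA.
have sin_h : 0 < sin h.
  have kn_gt0 : 0 < k%:R / n%:R :> R by rewrite divr_gt0 // ltr0n.
  apply: sin_gt0_pi; rewrite /h -mulrA mulr_gt0 ?pi_gt0 //=.
  by rewrite gtr_pMr ?pi_gt0 // ltr_pdivrMr // mul1r ltr_nat.
rewrite eq_complex /= cos_mulr2n negb_and; apply/orP; left.
have sin2_gt0 : 0 < sin h ^+ 2 by rewrite exprn_gt0.
by rewrite lt_eqF // cos2sin2; lra.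
Qed.

Lemma FpTrD a b : FpTr charFp (a + b) = FpTr charFp a + FpTr charFp b.
Proof.
apply: (fmorph_inj (in_alg (pPrimeCharType charFp))).
by rewrite rmorphD /= !FpTrE; exact: raddfD.
Qed.

(** The trace is the sum of the automorphisms, and distinct automorphisms are
    linearly independent. *)
Lemma FpTr_neq0 : exists a, FpTr charFp a != 0.
Proof.
pose L : splittingFieldType 'F_p := pPrimeCharType charFp.
have [a Ea] : exists a : L, galTrace 1%AS {:L} a != 0.
  pose c (_ : gal_of {:L}) : L := 1.
  have [||a _ Ea] := @gal_independent_contra _ L _ [in 'Gal({:L} / 1%AS)%g] c 1%g.
  - exact: group1.
  - exact: oner_neq0.
  exists a; move: Ea; congr (_ != _).
  by apply: eq_bigr => g _; rewrite mul1r.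
exists a; apply: contraNneq Ea => tr0.
by rewrite -(FpTrE (a : pPrimeCharType charFp)) tr0 scale0r.
Qed.

(** The representatives of a sum and the sum of representatives agree modulo p,
    hence their angles agree modulo a full turn. *)
Lemma addcharD a b : addchar (a + b) = addchar a * addchar b.
Proof.
have p_pr := pcharf_prime charFp.
have p0 : p%:R != 0 :> R by rewrite pnatr_eq0 -lt0n prime_gt0.
rewrite /addchar -expiD FpTrD; have := expi_2pi_nat; set c : R := _ * pi => c_nat.
rewrite -mulrDl -mulrDr -natrD.
set s := FpTr _ a; set t := FpTr _ b.
have -> : ((s + t)%R : nat) = ((s + t) %% p)%N.
  exact: (congr1 (modn (s + t)) (Fp_cast p_pr)).
rewrite [in RHS](divn_eq (s + t) p) natrD mulrDr mulrDl expiD.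
by rewrite natrM mulrA mulfK // c_nat mul1r.
Qed.

Lemma addchar0 : addchar 0 = 1.
Proof.
have FpTr0 : FpTr charFp 0 = 0.
  by apply: (addIr (FpTr charFp 0)); rewrite -FpTrD !add0r.
by rewrite /addchar FpTr0 /= mulr0 mul0r /expi cos0 sin0.
Qed.

Lemma addchar_neq1 : exists a, addchar a != 1.
Proof.
have [a tra] := FpTr_neq0; exists a; apply: expi_root_neq1.
rewrite lt0n [X in (_ < X)%N]/= -[X in (_ < X)%N](Fp_cast (pcharf_prime charFp)).
by rewrite ltn_ord andbT.
Qed.

(** Scaling moves any vector outside the kernel of f to one where the character
    is not 1; translation by that vector multiplies the sum by a number other
    than 1. *)
Lemma addchar_sum (V : finLmodType F) (f : V -> F) :
    {morph f : u v / u + v} -> (forall a, {morph f : v / a *: v >-> a * v}) ->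
  \sum_(v : V) addchar (f v) = if [forall v, f v == 0] then #|V|%:R else 0.
Proof.
move=> fD fZ; case: ifPn => [/forallP f0 | /forallPn[v fv0]].
  by under eq_bigr => v _ do rewrite (eqP (f0 v)) addchar0; rewrite sumr_const.
have [a ca] := addchar_neq1; pose w := (a / f v) *: v.
have fw : f w = a by rewrite fZ divfK.
set S := \sum_(v : V) _; have: S = addchar a * S.
  rewrite mulr_sumr /S (reindex_inj (addrI w)) /=.
  by apply: eq_bigr => u _; rewrite fD fw addcharD.
move/eqP; rewrite -subr_eq0 -{1}[S]mul1r -mulrBl mulf_eq0 subr_eq0 eq_sym.
by rewrite (negPf ca) => /eqP.
Qed.

End AdditiveCharacter.

(** * Products of linear forms and the group action *)

Section FormsAndAction.
Variable F : finFieldType.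
Implicit Types (a b c d e f t : F) (v L M : 'rV[F]_3) (x y z : 'rV[F]_6).

Definition vec3 a b c : 'rV[F]_3 := \row_(i < 3) [:: a; b; c]`_i.

Lemma vec3E a b c k : (k < 3)%N -> vec3 a b c 0 (inord k) = [:: a; b; c]`_k.
Proof. by move=> lt_k3; rewrite mxE inordK. Qed.

Lemma vec3_eta v : vec3 (v 0 (inord 0)) (v 0 (inord 1)) (v 0 (inord 2)) = v.
Proof.
apply/rowP=> i; rewrite mxE -[i in RHS]inord_val.
by case: i; do 3?[case=> [|] //=].
Qed.

Lemma vec3_inj a b c a' b' c' :
  vec3 a b c = vec3 a' b' c' -> [/\ a = a', b = b' & c = c'].
Proof.
move=> eqv; have E k : (k < 3)%N -> [:: a; b; c]`_k = [:: a'; b'; c']`_k.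
  by move=> ltk3; rewrite -!vec3E // eqv.
by split; [apply: (E 0%N) | apply: (E 1%N) | apply: (E 2%N)].
Qed.

Lemma qform_inj a b c d e f a' b' c' d' e' f' :
  qform a b c d e f = qform a' b' c' d' e' f' ->
  [/\ [/\ a = a', b = b' & c = c'] & [/\ d = d', e = e' & f = f']].
Proof.
move=> eqx; have E k : (k < 6)%N ->
    [:: a; b; c; d; e; f]`_k = [:: a'; b'; c'; d'; e'; f']`_k.
  by move=> ltk6; rewrite -!qformE // eqx.
by split; split; [apply: (E 0%N) | apply: (E 1%N) | apply: (E 2%N)
               | apply: (E 3%N) | apply: (E 4%N) | apply: (E 5%N)].
Qed.

Lemma qeval_vec3 a b c d e f r s t :
  qeval (qform a b c d e f) (vec3 r s t) =
    a * r ^+ 2 + b * (r * s) + c * (r * t) + d * s ^+ 2 + e * (s * t) + f * t ^+ 2.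
Proof. by rewrite /qeval !qformE // !vec3E. Qed.

(** Polarization recovers the coefficients from the values. *)
Lemma qeval_inj x y : qeval x =1 qeval y -> x = y.
Proof. by move=> eqxy; rewrite -(qevalK x) -(qevalK y) /qform_of !eqxy. Qed.

(** Rows of length 3 serve both as vectors and as linear forms; the pairing of
    the two is the standard one. *)
Definition lform L v : F := (v *m L^T) 0 0.

Lemma lformE L v : lform L v =
  v 0 (inord 0) * L 0 (inord 0) + v 0 (inord 1) * L 0 (inord 1)
    + v 0 (inord 2) * L 0 (inord 2).
Proof.
rewrite /lform mxE 3!big_ord_recl big_ord0 addr0 addrA !mxE.
by congr (v 0 _ * L 0 _ + v 0 _ * L 0 _ + v 0 _ * L 0 _);
   apply: val_inj; rewrite /= inordK.
Qed.

Definition lprod L M : 'rV[F]_6 :=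
  let l k := L 0 (inord k) in let m k := M 0 (inord k) in
  qform (l 0%N * m 0%N) (l 0%N * m 1%N + l 1%N * m 0%N)
        (l 0%N * m 2%N + l 2%N * m 0%N)
        (l 1%N * m 1%N) (l 1%N * m 2%N + l 2%N * m 1%N) (l 2%N * m 2%N).

Lemma lprod_vec3 a b c d e f : lprod (vec3 a b c) (vec3 d e f) =
  qform (a * d) (a * e + b * d) (a * f + c * d) (b * e) (b * f + c * e) (c * f).
Proof. by rewrite /lprod !vec3E. Qed.

Lemma qeval_lprod L M v : qeval (lprod L M) v = lform L v * lform M v.
Proof. by rewrite /qeval /lprod !qformE //= !lformE; ring. Qed.

Lemma GLval_unitmx (g : {'GL_3[F]}) : GLval g \in unitmx.
Proof. exact: GL_unitmx. Qed.

(** The action multiplies the pullbacks of the two forms; the scalar may be put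
    on either of them. *)
Lemma qact_lprod g L M : qact g (lprod L M) =
  lprod (val g.1 *: (L *m (GLval g.2)^T)) (M *m (GLval g.2)^T).
Proof.
apply: qeval_inj => v; rewrite qeval_qact !qeval_lprod mulrA; congr (_ * _).
  rewrite /lform linearZ /= -scalemxAr trmx_mul trmxK mulmxA.
  by rewrite [RHS]mxE.
by rewrite /lform trmx_mul trmxK mulmxA.
Qed.

Lemma qact_inj g : injective (@qact F g).
Proof.
move=> x y eqxy; apply: qeval_inj => v.
have := congr1 (fun z => qeval z (v *m invmx (GLval g.2))) eqxy.
rewrite !qeval_qact mulmxKV ?GLval_unitmx //; apply: mulfI.
by rewrite -unitfE; apply: valP.
Qed.

Lemma mem_qorbit t (A : 'M[F]_3) x y : t != 0 -> A \in unitmx ->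
  (forall v, qeval y v = t * qeval x (v *m A)) -> y \in qorbit x.
Proof.
rewrite -unitfE => Ut UA yE; apply/imsetP.
exists (FinRing.Unit Ut, FinRing.Unit (UA : (A : 'M_3) \is a GRing.unit)) => //.
by apply: qeval_inj => v; rewrite qeval_qact yE.
Qed.

Lemma qorbit_trans x y z : y \in qorbit x -> z \in qorbit y -> z \in qorbit x.
Proof.
move=> /imsetP[g _ ->] /imsetP[h _ ->].
apply: (@mem_qorbit (val h.1 * val g.1) (GLval h.2 *m GLval g.2)).
- by rewrite mulf_neq0 // -unitfE; apply: valP.
- by rewrite unitmx_mul; apply/andP; split; apply: GLval_unitmx.
- by move=> v; rewrite !qeval_qact mulmxA mulrA.
Qed.

Lemma qorbit_refl x : x \in qorbit x.
Proof.
apply: (@mem_qorbit 1 1%:M); rewrite ?oner_neq0 ?unitmx1 // => v.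
by rewrite mul1r mulmx1.
Qed.

Lemma qorbit0 : qorbit 0 = [set 0 : 'rV[F]_6].
Proof.
have qeval0 v : qeval 0 v = 0 :> F by rewrite /qeval !mxE; ring.
apply/setP=> x; rewrite inE; apply/imsetP/eqP=> [[g _ ->]|->].
  by apply: qeval_inj => v; rewrite qeval_qact !qeval0 mulr0.
exists (1%g, 1%g) => //.
by apply: qeval_inj => v; rewrite qeval_qact !qeval0 mulr0.
Qed.

Definition mx3 (r0 r1 r2 : 'rV[F]_3) : 'M[F]_3 := \matrix_(i < 3) [:: r0; r1; r2]`_i.

Lemma mul_vec3_mx3 a b c r0 r1 r2 :
  vec3 a b c *m mx3 r0 r1 r2 = a *: r0 + b *: r1 + c *: r2.
Proof.
by rewrite mulmx_sum_row 3!big_ord_recl big_ord0 addr0 addrA !rowK !mxE.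
Qed.

Lemma lin_vec3 a b c r s t r' s' t' r'' s'' t'' :
  vec3 a b c *m mx3 (vec3 r s t) (vec3 r' s' t') (vec3 r'' s'' t'') =
    vec3 (a * r + b * r' + c * r'') (a * s + b * s' + c * s'')
         (a * t + b * t' + c * t'').
Proof.
rewrite mul_vec3_mx3; apply/rowP=> i; rewrite !mxE.
by case: i; do 3?[case=> [|] //=].
Qed.

Lemma det_mx3 r s t r' s' t' r'' s'' t'' :
  \det (mx3 (vec3 r s t) (vec3 r' s' t') (vec3 r'' s'' t'')) =
    r * (s' * t'' - t' * s'') - s * (r' * t'' - t' * r'') + t * (r' * s'' - s' * r'').
Proof.
rewrite (expand_det_row _ ord0) 3!big_ord_recl big_ord0 /cofactor.
rewrite !(expand_det_row _ ord0) !big_ord_recl !big_ord0 /cofactor !det_mx11 !mxE /=.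
by rewrite /bump /=; ring.
Qed.

Lemma qbilZl t x y : qbil (t *: x) y = t * qbil x y.
Proof. by rewrite /qbil !mxE; ring. Qed.

Lemma qbilDl x y z : qbil (x + y) z = qbil x z + qbil y z.
Proof. by rewrite /qbil !mxE; ring. Qed.

Lemma qbilDr x y z : qbil x (y + z) = qbil x y + qbil x z.
Proof. by rewrite /qbil !mxE; ring. Qed.

Lemma qbilC x y : qbil x y = qbil y x.
Proof. by rewrite /qbil; ring. Qed.

Lemma lprodC L M : lprod L M = lprod M L.
Proof. by apply: qeval_inj => v; rewrite !qeval_lprod mulrC. Qed.

Lemma lprodDr L M N : lprod L (M + N) = lprod L M + lprod L N.
Proof.
have qevalD x y v : qeval (x + y) v = qeval x v + qeval y v.
  by rewrite /qeval !mxE; ring.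
have lformD v : lform (M + N) v = lform M v + lform N v.
  by rewrite !lformE !mxE; ring.
by apply: qeval_inj => v; rewrite qevalD !qeval_lprod lformD mulrDr.
Qed.

Lemma lprodZr t L M : lprod L (t *: M) = t *: lprod L M.
Proof.
apply: qeval_inj => v; rewrite qeval_lprod.
by rewrite /qeval /lprod mxE !mxE /= !inordK //= !lformE !mxE; ring.
Qed.

Hypothesis two_neq0 : 2%:R != 0 :> F.

(** The weights 1/2 on the mixed coefficients in the bilinear form cancel the 2
    that these coefficients have in a square. *)
Lemma qbil_lprod_sq L y : qbil (lprod L L) y = qeval y L.
Proof. by rewrite /qbil /qeval /lprod !qformE //=; field. Qed.

Lemma qbil_lprod L M y :
  2%:R * qbil (lprod L M) y = qeval y (L + M) - qeval y L - qeval y M.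
Proof. by rewrite /qbil /qeval /lprod !qformE //= !mxE; field. Qed.

End FormsAndAction.

(** * Squares in a finite field *)

Section Squares.
Variable F : finFieldType.
Implicit Types (l m s t z : F).

Definition squares : {set F} := [set z ^+ 2 | z : F].

(** The fibres of squaring have at most two elements, and the one over 0 has only
    one; the latter makes the inequality strict. *)
Lemma card_squares : (#|F| < 2 * #|squares|)%N.
Proof.
have sq0 : 0 \in squares by apply/imsetP; exists 0; rewrite ?expr0n.
have -> : #|F| = (\sum_(y in squares) #|[set z : F | z ^+ 2 == y]|)%N.
  rewrite -sum1_card (partition_big_imset (fun z : F => z ^+ 2)) /=.
  by apply: eq_bigr => y _; rewrite -sum1dep_card.
rewrite (bigD1 0) //= (cardsD1 0 squares) sq0 mulnDr muln1 addSn ltnS.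
apply: leq_add.
  rewrite (_ : [set z | _] = [set 0]) ?cards1 //.
  by apply/setP=> z; rewrite !inE sqrf_eq0.
rewrite mulnC -sum_nat_const.
rewrite (eq_bigl (fun y => y \in squares :\ 0)); last first.
  by move=> y; rewrite !inE andbC.
apply: leq_sum => y; rewrite !inE => /andP[_ /imsetP[z _ ->]].
apply: (@leq_trans #|[set z; - z]|); last by rewrite cards2; case: (_ != _).
apply: subset_leq_card; apply/subsetP=> t; rewrite !inE.
by rewrite eqf_sqr.
Qed.

Lemma card_square_multiples l : l != 0 -> #|[set l * y | y in squares]| = #|squares|.
Proof. by move=> l0; apply: card_imset; apply: mulfI. Qed.

(** Both $l s^2$ and $c - m t^2$ take more than half of all values, so that they
    have a value in common. *)
Lemma sum_two_squares_onto l m c : l != 0 -> m != 0 ->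
  exists s t, l * s ^+ 2 + m * t ^+ 2 = c.
Proof.
move=> l0 m0.
pose A := [set l * y | y in squares].
pose B := [set c - y | y in [set m * y | y in squares]].
have cardA : #|A| = #|squares| by apply: card_square_multiples.
have cardB : #|B| = #|squares|.
  by rewrite card_imset ?card_square_multiples // => u v /addrI/oppr_inj.
have: ~~ [disjoint A & B].
  apply/negP=> dAB; have := card_squares; rewrite ltnNge => /negP[].
  rewrite mul2n -addnn -{1}cardA -cardB -cardsUI (disjoint_setI0 dAB) cards0 addn0.
  exact: max_card.
case/pred0Pn=> x /andP[/imsetP[_ /imsetP[s _ ->] ->]].
case/imsetP=> _ /imsetP[_ /imsetP[t _ ->] ->] E.
by exists s, t; rewrite E subrK.
Qed.

(** The squares and their multiples by l are too many to avoid m, because they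
    have only 0 in common. *)
Lemma nonsquare_ratio l m : l \notin squares -> m \notin squares ->
  exists s, m = l * s ^+ 2.
Proof.
move=> nl nm.
have l0 : l != 0.
  by apply: contraNneq nl => ->; apply/imsetP; exists 0; rewrite ?expr0n.
pose A := [set l * y | y in squares].
have [/imsetP[_ /imsetP[s _ ->] ->]|mA] := boolP (m \in A); first by exists s.
have cardA : #|A| = #|squares| by apply: card_square_multiples.
have := card_squares; rewrite ltnNge => /negP[].
rewrite mul2n -addnn -{1}cardA -cardsUI.
have sU : (A :|: squares) \subset [set~ m].
  apply/subsetP=> x; rewrite !inE => /orP[xA|xS].
    by apply: contraNneq mA => <-.
  by apply: contraNneq nm => <-.
have sI : (A :&: squares) \subset [set 0].
  apply/subsetP=> x; rewrite !inE => /andP[/imsetP[_ /imsetP[s _ ->] ->]].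
  case/imsetP=> t _ E; apply: contraNT nl => nz.
  have s0 : s != 0 by apply: contraNneq nz => ->; rewrite expr0n mulr0.
  apply/imsetP; exists (t / s) => //.
  by rewrite expr_div_n -E mulfK // expf_neq0.
apply: leq_trans (leq_add (subset_leq_card sU) (subset_leq_card sI)) _.
by rewrite cards1 cardsC1 addn1 prednK //; apply/card_gt0P; exists m.
Qed.

End Squares.

(** * Reduction of a form to a representative *)

Section Classification.
Variable F : finFieldType.
Hypothesis two_neq0 : 2%:R != 0 :> F.
Variable l : F.
Hypothesis l_nonsquare : l \notin squares F.
Implicit Types (a b c d e f t : F) (v L M : 'rV[F]_3) (x y z : 'rV[F]_6).

(** Gaussian elimination completes a multiple of v to a basis. *)
Lemma exists_unitmx_row v : v != 0 ->
  exists2 A : 'M[F]_3, A \in unitmx & exists2 c : F, c != 0 & v = c *: row 0 A.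
Proof.
move=> v0; exists (row_ebase v); first exact: row_ebase_unit.
have := mulmx_ebase v; rewrite rank_rV v0 /=.
rewrite [col_ebase v]mx11_scalar mul_scalar_mx -scalemxAl.
set c := _ 0 0 => E; exists c.
  by apply: contraNneq v0 => c0; rewrite -E c0 scale0r.
rewrite -[LHS]E rowE; congr (_ *: (_ *m _)).
by apply/matrixP=> i j; rewrite !mxE !ord1 /= andbT eq_sym.
Qed.

Lemma qeval_eq0P x : reflect (qeval x =1 fun=> 0) (x == 0).
Proof.
have qeval0 v : qeval 0 v = 0 :> F by rewrite /qeval !mxE; ring.
apply: (iffP eqP) => [-> // | x0]; apply: qeval_inj => v.
by rewrite x0 qeval0.
Qed.

(** For an explicit substitution, membership in an orbit becomes a nonzero
    determinant and a polynomial identity. *)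
Lemma qorbit_subst t x y r s u r' s' u' r'' s'' u'' :
  let A := mx3 (vec3 r s u) (vec3 r' s' u') (vec3 r'' s'' u'') in
  t != 0 -> \det A != 0 ->
  (forall a b c, qeval y (vec3 a b c) = t * qeval x (vec3 a b c *m A)) ->
  y \in qorbit x.
Proof.
move=> A t0 dA yE; apply: (mem_qorbit (A := A) t0); first by rewrite unitmxE unitfE.
by move=> v; rewrite -[v]vec3_eta yE.
Qed.

(** A vector at which x is not zero is taken as the first vector of a basis. *)
Lemma qorbit_lead_neq0 x : x != 0 -> exists a b c d e f,
  a != 0 /\ x \in qorbit (qform a b c d e f).
Proof.
move=> x0; have [v xv0] : exists v, qeval x v != 0.
  apply/existsP; rewrite -negb_forall; apply: contraNN x0 => /forallP x0.
  by apply/qeval_eq0P => v; apply/eqP/x0.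
have v0 : v != 0.
  by apply: contraNneq xv0 => ->; rewrite /qeval !mxE; apply/eqP; ring.
have [A UA [c c0 vE]] := exists_unitmx_row v0.
pose y := qform_of (fun w => qeval x (w *m A)).
have yE w : qeval y w = qeval x (w *m A).
  pose g : {unit F} * {'GL_3[F]} :=
    (1%g, FinRing.Unit (UA : (A : 'M_3) \is a GRing.unit)).
  have <- : Defs.qact g x = y.
    by apply: qeval_inj => u; rewrite /Defs.qact /y /qform_of /= !mul1r.
  by rewrite qeval_qact mul1r.
exists (y 0 (inord 0)), (y 0 (inord 1)), (y 0 (inord 2)).
exists (y 0 (inord 3)), (y 0 (inord 4)), (y 0 (inord 5)); split.
  apply: contraNneq xv0 => y0; rewrite vE.
  have -> : c *: row 0 A = vec3 c 0 0 *m A.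
    rewrite rowE scalemxAl; congr (_ *m _).
    apply/rowP=> i; rewrite !mxE /=.
    by case: i; do 3?[case=> [|] //=] => *; rewrite ?mulr1 ?mulr0.
  by rewrite -yE -[y]qform_eta qeval_vec3 y0; apply/eqP; ring.
rewrite qform_eta; apply: (mem_qorbit (A := invmx A) (oner_neq0 _)).
  by rewrite unitmx_inv; exact: UA.
by move=> w; rewrite mul1r yE mulmxKV.
Qed.

(** Once the factor a is taken out, the substitution of $u + (b/2a) v + (c/2a) w$
    for $u$ absorbs the terms in $uv$ and $uw$. *)
Lemma qorbit_complete_square a b c d e f : a != 0 -> exists d' e' f',
  qform a b c d e f \in qorbit (qform 1 0 0 d' e' f').
Proof.
move=> a0; pose h := (2%:R * a)^-1.
exists (d / a - (b * h) ^+ 2), (e / a - 2%:R * (b * h) * (c * h)), (f / a - (c * h) ^+ 2).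
apply: (@qorbit_subst a _ _ 1 0 0 (b * h) 1 0 (c * h) 0 1) => //.
  by rewrite det_mx3 !(mulr0, mulr1, mul0r, subr0, addr0) oner_neq0.
move=> r s t; rewrite lin_vec3 !qeval_vec3 /h; field; rewrite a0 two_neq0 //.
Qed.

(** When both squares in the binary part are missing, no completion of squares is
    possible; but then $u^2 + evw$ is $u^2 - vw$ up to a scaling of $v$, unless
    $e = 0$. *)
Lemma qorbit_diag d e f : [\/ d = 0 /\ f = 0 /\ e = 0,
   qform 1 0 0 d e f \in qorbit (qform 1 0 0 0 (- 1) 0) |
   exists d' f', d' != 0 /\ qform 1 0 0 d e f \in qorbit (qform 1 0 0 d' 0 f')].
Proof.
have [d0|d0] := eqVneq d 0; last first.
  apply: Or33; exists d, (f - e ^+ 2 / (4%:R * d)); split=> //.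
  apply: (@qorbit_subst 1 _ _ 1 0 0 0 1 0 0 (e / (2%:R * d)) 1); rewrite ?oner_neq0 //.
    by rewrite det_mx3 !(mulr0, mulr1, mul0r, subr0, addr0) oner_neq0.
  move=> r s t; rewrite lin_vec3 !qeval_vec3.
  have four_neq0 : 4%:R != 0 :> F by rewrite (natrM _ 2 2) mulf_neq0.
  by field; rewrite d0 four_neq0.
have [f0|f0] := eqVneq f 0; last first.
  apply: Or33; exists f, (d - e ^+ 2 / (4%:R * f)); split=> //.
  apply: (@qorbit_subst 1 _ _ 1 0 0 0 (e / (2%:R * f)) 1 0 1 0); rewrite ?oner_neq0 //.
    by rewrite det_mx3 !(mulr0, mulr1, mul0r, subr0, addr0, sub0r, mul1r) oppr_eq0 oner_neq0.
  move=> r s t; rewrite lin_vec3 !qeval_vec3.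
  have four_neq0 : 4%:R != 0 :> F by rewrite (natrM _ 2 2) mulf_neq0.
  by field; rewrite f0 four_neq0.
have [e0|e0] := eqVneq e 0; first by apply: Or31.
apply: Or32; rewrite d0 f0.
apply: (@qorbit_subst 1 _ _ 1 0 0 0 (- e) 0 0 0 1); rewrite ?oner_neq0 //.
  by rewrite det_mx3 !(mulr0, mulr1, mul0r, subr0, addr0, sub0r, mul1r) oppr_eq0.
by move=> r s t; rewrite lin_vec3 !qeval_vec3; ring.
Qed.

(** $u^2 + dv^2$ factors when $-d$ is a square, and $-d$ is $l$ times a square
    otherwise. *)
Lemma qorbit_binary d : d != 0 ->
  qform 1 0 0 d 0 0 \in qorbit (qform 0 1 0 0 0 0) \/
  qform 1 0 0 d 0 0 \in qorbit (qform 1 0 0 (- l) 0 0).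
Proof.
move=> d0; have [/imsetP[s _ E]|nd] := boolP (- d \in squares F); [left|right].
  have s0 : s != 0 by apply: contraNneq d0 => s0; rewrite -oppr_eq0 E s0 expr0n.
  have -> : d = - s ^+ 2 by rewrite -E opprK.
  apply: (@qorbit_subst 1 _ _ 1 1 0 s (- s) 0 0 0 1); rewrite ?oner_neq0 //.
    rewrite det_mx3 (_ : _ + _ = - (2%:R * s)); last by ring.
    by rewrite oppr_eq0 mulf_neq0.
  by move=> r u t; rewrite lin_vec3 !qeval_vec3; ring.
have [s E] := nonsquare_ratio l_nonsquare nd.
have s0 : s != 0.
  by apply: contraNneq d0 => s0; rewrite -oppr_eq0 E s0 expr0n mulr0.
have -> : d = - (l * s ^+ 2) by rewrite -E opprK.
apply: (@qorbit_subst 1 _ _ 1 0 0 0 s 0 0 0 1); rewrite ?oner_neq0 //.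
  by rewrite det_mx3 !(mulr0, mulr1, mul0r, subr0, addr0, sub0r, mul1r).
by move=> r u t; rewrite lin_vec3 !qeval_vec3; ring.
Qed.

(** Choose $ds^2 + ft^2 = -1$. In the orthogonal basis $(s, t)$, $(-ft, ds)$ of
    the plane, $dv^2 + fw^2$ becomes $-y^2 - df z^2$ with $y = -(dsv + ftw)$ and
    $z = tv - sw$. Hence the form is $(u - y)(u + y) - df z^2$, which is
    $-df (z^2 - VW)$ for $V = (u - y)/(df)$ and $W = u + y$. *)
Lemma qorbit_ternary d f : d != 0 -> f != 0 ->
  qform 1 0 0 d 0 f \in qorbit (qform 1 0 0 0 (- 1) 0).
Proof.
move=> d0 f0.
have [s [t E]] := sum_two_squares_onto (- 1) d0 f0.
have df0 : d * f != 0 by rewrite mulf_neq0.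
pose k := (d * f)^-1.
(* The columns of the substitution are z, V and W. *)
apply: (@qorbit_subst (- (d * f)) _ _ 0 k 1 t (k * d * s) (- (d * s))
          (- s) (k * f * t) (- (f * t))); first by rewrite oppr_eq0.
  rewrite det_mx3 (_ : _ + _ = 2%:R * k * (d * s ^+ 2 + f * t ^+ 2)); last by ring.
  by rewrite E !mulf_neq0 ?oppr_eq0 ?oner_neq0 ?invr_eq0.
move=> a b c; rewrite lin_vec3 !qeval_vec3.
transitivity (a ^+ 2 - (d * s ^+ 2 + f * t ^+ 2) * (d * b ^+ 2 + f * c ^+ 2)).
  by rewrite E; ring.
by rewrite /k; field; rewrite d0 f0.
Qed.

Lemma qorbit_exhaust x : exists i : 'I_5, x \in qorbit (orbit_rep l i).
Proof.
have [->|x0] := eqVneq x 0; first by exists (inord 0); rewrite /orbit_rep inordK // qorbit_refl.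
have [a [b [c [d [e [f [a0 xE]]]]]]] := qorbit_lead_neq0 x0.
have [d1 [e1 [f1 /qorbit_trans-/(_ _ xE) {}xE]]] := qorbit_complete_square b c d e f a0.
have [[d0 [f0 e0]] | | [d2 [f2 [d20]]]] := qorbit_diag d1 e1 f1.
- by exists (inord 1); move: xE; rewrite d0 e0 f0 /orbit_rep inordK.
- by move=> /qorbit_trans-/(_ _ xE) {}xE; exists (inord 4); rewrite /orbit_rep inordK.
move=> /qorbit_trans-/(_ _ xE) {}xE.
have [f0|f0] := eqVneq f2 0; last first.
  exists (inord 4); rewrite /orbit_rep inordK //=.
  exact: qorbit_trans (qorbit_ternary d20 f0) xE.
rewrite f0 in xE.
have [/qorbit_trans-/(_ _ xE) {}xE | /qorbit_trans-/(_ _ xE) {}xE] := qorbit_binary d20.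
  by exists (inord 2); rewrite /orbit_rep inordK.
by exists (inord 3); rewrite /orbit_rep inordK.
Qed.

End Classification.

(** * Counting functions that are constant on orbits *)

Section Invariants.
Variable F : finFieldType.
Hypothesis two_neq0 : 2%:R != 0 :> F.
Implicit Types (a b c d e f t : F) (v L M : 'rV[F]_3) (x y z : 'rV[F]_6).

Definition num_zeros y := #|[set v | qeval y v == 0]|.

Definition num_radical y := #|[set L | [forall M, qbil (lprod L M) y == 0]]|.

Definition num_products x :=
  #|[set z : 'rV[F]_3 * 'rV[F]_3 | lprod z.1 z.2 == x]|.

Definition num_squares x :=
  #|[set z : F * 'rV[F]_3 | z.1 *: lprod z.2 z.2 == x]|.

Definition qinvariant (f : 'rV[F]_6 -> nat) := forall g x, f (qact g x) = f x.

Lemma mulmx_GL_inj (g : {'GL_3[F]}) : injective (fun v => v *m GLval g).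
Proof. by apply: can_inj (mulmxK _); apply: GLval_unitmx. Qed.

Lemma mulmx_trGL_inj (g : {'GL_3[F]}) : injective (fun v => v *m (GLval g)^T).
Proof. by apply: can_inj (mulmxK _); rewrite unitmx_tr; apply: GLval_unitmx. Qed.

Lemma num_zeros_invariant : qinvariant num_zeros.
Proof.
move=> g x; have g1 : val g.1 != 0 by rewrite -unitfE; apply: valP.
rewrite /num_zeros -[RHS](card_preimset _ (@mulmx_GL_inj g.2)).
by apply: eq_card => v; rewrite !inE qeval_qact mulf_eq0 (negPf g1).
Qed.

(** By polarization, the action changes the bilinear form of x by the substitution
    in both arguments and a scalar. *)
Lemma num_radical_invariant : qinvariant num_radical.
Proof.
move=> g x; rewrite /num_radical -[RHS](card_preimset _ (@mulmx_GL_inj g.2)).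
have g1 : val g.1 != 0 by rewrite -unitfE; apply: valP.
have E L M : qbil (lprod L M) (qact g x) =
    val g.1 * qbil (lprod (L *m GLval g.2) (M *m GLval g.2)) x.
  apply: (mulfI two_neq0); rewrite qbil_lprod // mulrCA qbil_lprod //.
  by rewrite !qeval_qact mulmxDl; ring.
apply: eq_card => L; rewrite !inE; apply/forallP/forallP=> H M.
  have := H (M *m invmx (GLval g.2)).
  by rewrite E mulmxKV ?GLval_unitmx // mulf_eq0 (negPf g1).
by rewrite E mulf_eq0 (eqP (H _)) eqxx orbT.
Qed.

Lemma num_products_invariant : qinvariant num_products.
Proof.
move=> g x; have g1 : val g.1 != 0 by rewrite -unitfE; apply: valP.
pose h (z : 'rV[F]_3 * 'rV[F]_3) :=
  (val g.1 *: (z.1 *m (GLval g.2)^T), z.2 *m (GLval g.2)^T).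
have h_inj : injective h.
  by move=> [L M] [L' M'] [/(scalerI g1)/mulmx_trGL_inj-> /mulmx_trGL_inj->].
rewrite /num_products -(card_preimset _ h_inj); apply: eq_card => z; rewrite !inE.
by rewrite -qact_lprod (inj_eq (@qact_inj _ g)).
Qed.

Lemma num_squares_invariant : qinvariant num_squares.
Proof.
move=> g x; have g1 : val g.1 != 0 by rewrite -unitfE; apply: valP.
pose h (z : F * 'rV[F]_3) := (val g.1 * z.1, z.2 *m (GLval g.2)^T).
have h_inj : injective h.
  by move=> [t L] [t' L'] [/(mulfI g1)-> /mulmx_trGL_inj->].
rewrite /num_squares -(card_preimset _ h_inj); apply: eq_card => z; rewrite !inE.
rewrite -[RHS](inj_eq (@qact_inj _ g)) -[in RHS]lprodZr qact_lprod.
by rewrite -scalemxAl lprodZr [in RHS]lprodC lprodZr scalerA [in RHS]mulrC.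
Qed.

Lemma invariant_qorbit (f : _ -> nat) x y : qinvariant f -> y \in qorbit x -> f y = f x.
Proof. by move=> fI /imsetP[g _ ->]; apply: fI. Qed.

(** The scalar -1 belongs to the group. *)
Lemma num_productsN x : num_products (- x) = num_products x.
Proof.
have N1 : (-1 : F) \is a GRing.unit by rewrite unitrN1.
rewrite -(num_products_invariant (FinRing.Unit N1, 1%g) x); congr num_products.
apply: qeval_inj => v; rewrite qeval_qact /= mulmx1 mulN1r.
by rewrite /qeval !mxE; ring.
Qed.

Local Notation q := #|F|.

(** ** Values at the representatives *)

Lemma card_vec3 (P : pred 'rV[F]_3) :
  #|[set v | P v]| = (\sum_a \sum_b \sum_c P (vec3 a b c))%N.
Proof.
pose h (z : F * F * F) := vec3 z.1.1 z.1.2 z.2.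
pose h' v : F * F * F := (v 0 (inord 0), v 0 (inord 1), v 0 (inord 2)).
rewrite pair_big pair_big /= -sum1dep_card big_mkcond /=.
rewrite (reindex h) /=; first by apply: eq_bigr => z _; rewrite /h; case: (P _).
exists h'; last by move=> v _; apply: vec3_eta.
by case=> [[a b] c] _; rewrite /h /h' /= !vec3E.
Qed.

Lemma sum_pred1 a : (\sum_(b : F) (b == a) = 1)%N.
Proof. by rewrite (bigD1 a) //= eqxx big1 // => b /negPf->. Qed.

Lemma sum_const_card n : (\sum_(b : F) n = q * n)%N.
Proof. by rewrite sum_nat_const. Qed.

Lemma card_nonzero : #|[set t : F | t != 0]| = q.-1.
Proof. by rewrite -(cardsC1 (0 : F)); apply: eq_card => t; rewrite !inE. Qed.

Lemma num_zeros0 : num_zeros 0 = (q ^ 3)%N.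
Proof.
rewrite /num_zeros -[(q ^ 3)%N](card_mx F 1 3) -cardsT; apply: eq_card => v.
by rewrite !inE; apply/eqP; rewrite /qeval !mxE; ring.
Qed.

Lemma num_zeros_u2 : num_zeros (qform 1 0 0 0 0 0) = (q ^ 2)%N.
Proof.
rewrite /num_zeros card_vec3.
under eq_bigr => a _ do under eq_bigr => b _ do under eq_bigr => c _ do
  rewrite qeval_vec3 !mul0r !addr0 mul1r sqrf_eq0.
under eq_bigr => a _ do rewrite sum_const_card sum_const_card mulnA.
by rewrite -big_distrr /= sum_pred1 muln1.
Qed.

Lemma num_zeros_uv : num_zeros (qform 0 1 0 0 0 0) = (q * (q + q.-1))%N.
Proof.
rewrite /num_zeros card_vec3.
under eq_bigr => a _ do under eq_bigr => b _ do under eq_bigr => c _ do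
  rewrite qeval_vec3 !mul0r !addr0 add0r mul1r mulf_eq0.
under eq_bigr => a _ do under eq_bigr => b _ do rewrite sum_const_card.
under eq_bigr => a _ do rewrite -big_distrr.
rewrite -big_distrr /=; congr (_ * _)%N.
rewrite (bigD1 0) //= eqxx /= sum_const_card muln1; congr (_ + _)%N.
under eq_bigr => a a0 do rewrite (negPf a0) /= sum_pred1.
by rewrite sum1dep_card card_nonzero.
Qed.

Lemma num_zeros_aniso l : l \notin squares F ->
  num_zeros (qform 1 0 0 (- l) 0 0) = q.
Proof.
move=> nl; rewrite /num_zeros card_vec3.
under eq_bigr => a _ do under eq_bigr => b _ do under eq_bigr => c _ do
  rewrite qeval_vec3 !mul0r !addr0 mul1r mulNr subr_eq0.
have E a b : (a ^+ 2 == l * b ^+ 2) = (a == 0) && (b == 0).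
  apply/eqP/andP=> [E | [/eqP-> /eqP->]]; last by rewrite !expr0n mulr0.
  have [b0|b0] := eqVneq b 0.
    by move/eqP: E; rewrite b0 expr0n mulr0 sqrf_eq0 => /eqP->; rewrite eqxx.
  case/negP: nl; apply/imsetP; exists (a / b) => //.
  by rewrite expr_div_n E mulfK // expf_neq0.
under eq_bigr => a _ do under eq_bigr => b _ do 
  rewrite sum_const_card E -mulnb.
under eq_bigr => a _ do rewrite -big_distrr -big_distrr /= sum_pred1 muln1.
by rewrite -big_distrr /= sum_pred1 muln1.
Qed.

(** For each value of $v$ the equation $u^2 = vw$ has exactly q solutions: it
    determines $w$ if $v$ is not 0, and it says that $u = 0$ otherwise. *)
Lemma num_zeros_conic : num_zeros (qform 1 0 0 0 (- 1) 0) = (q ^ 2)%N.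
Proof.
rewrite /num_zeros card_vec3.
under eq_bigr => a _ do under eq_bigr => b _ do under eq_bigr => c _ do
  rewrite qeval_vec3 !mul0r !addr0 mul1r mulN1r subr_eq0.
rewrite exchange_big /=.
transitivity (\sum_(b : F) q)%N; last by rewrite sum_const_card.
apply: eq_bigr => b _; have [->|b0] := eqVneq b 0.
  under eq_bigr => a _ do under eq_bigr => c _ do rewrite mul0r sqrf_eq0.
  under eq_bigr => a _ do rewrite sum_const_card.
  by rewrite -big_distrr /= sum_pred1 muln1.
rewrite -[RHS]muln1 -sum_const_card; apply: eq_bigr => a _.
rewrite -[RHS](sum_pred1 (a ^+ 2 / b)); apply: eq_bigr => c _.
congr nat_of_bool; rewrite -[RHS](inj_eq (mulfI b0)).
by rewrite [b * (_ / b)]mulrCA divff // mulr1 eq_sym.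
Qed.

(** The three conditions are the rows of the Gram matrix, which is multiplied by 2
    so as to have the coefficients of the form as entries. *)
Lemma radical_vec3 a b c a' b' c' d' e' f' :
  [forall M, qbil (lprod (vec3 a b c) M) (qform a' b' c' d' e' f') == 0] =
  [&& 2%:R * a' * a + b' * b + c' * c == 0,
      b' * a + 2%:R * d' * b + e' * c == 0 &
      c' * a + e' * b + 2%:R * f' * c == 0].
Proof.
have E r s t : 2%:R * qbil (lprod (vec3 a b c) (vec3 r s t)) (qform a' b' c' d' e' f') =
   r * (2%:R * a' * a + b' * b + c' * c) + s * (b' * a + 2%:R * d' * b + e' * c)
   + t * (c' * a + e' * b + 2%:R * f' * c).
  rewrite qbil_lprod // !qeval_vec3.
  by rewrite {1}/qeval !qformE //= ![(vec3 _ _ _ + _) _ _]mxE !vec3E //=; ring.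
apply/forallP/and3P=> [H | [/eqP r0 /eqP s0 /eqP t0] M].
  split; apply/eqP.
  - by have := E 1 0 0; rewrite (eqP (H _)) mulr0 !mul0r !addr0 mul1r.
  - by have := E 0 1 0; rewrite (eqP (H _)) mulr0 !mul0r add0r addr0 mul1r.
  - by have := E 0 0 1; rewrite (eqP (H _)) mulr0 !mul0r !add0r mul1r.
apply/eqP/(mulfI two_neq0); rewrite mulr0 -[M]vec3_eta E r0 s0 t0.
by rewrite !mulr0 !addr0.
Qed.

Lemma two_mul_eq0 a : (2%:R * a == 0) = (a == 0).
Proof. by rewrite mulf_eq0 (negPf two_neq0). Qed.

Lemma num_radical0 : num_radical 0 = (q ^ 3)%N.
Proof.
rewrite /num_radical -[(q ^ 3)%N](card_mx F 1 3) -cardsT; apply: eq_card => v.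
by rewrite !inE; apply/forallP=> M; apply/eqP; rewrite /qbil !mxE; ring.
Qed.

Lemma num_radical_u2 : num_radical (qform 1 0 0 0 0 0) = (q ^ 2)%N.
Proof.
rewrite /num_radical card_vec3.
under eq_bigr => a _ do under eq_bigr => b _ do under eq_bigr => c _ do
  rewrite radical_vec3 !mulr0 !mul0r !addr0 eqxx mulr1 two_mul_eq0 !andbT.
under eq_bigr => a _ do rewrite sum_const_card sum_const_card mulnA.
by rewrite -big_distrr /= sum_pred1 muln1.
Qed.

Lemma num_radical_binary (x : 'rV[F]_6) :
  (forall a b c, [forall M, qbil (lprod (vec3 a b c) M) x == 0] =
     (a == 0) && (b == 0)) -> num_radical x = q.
Proof.
move=> radE; rewrite /num_radical card_vec3.
under eq_bigr => a _ do under eq_bigr => b _ do under eq_bigr => c _ do rewrite radE.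
under eq_bigr => a _ do under eq_bigr => b _ do rewrite sum_const_card -mulnb.
under eq_bigr => a _ do rewrite -big_distrr -big_distrr /= sum_pred1 muln1.
by rewrite -big_distrr /= sum_pred1 muln1.
Qed.

Lemma num_radical_uv : num_radical (qform 0 1 0 0 0 0) = q.
Proof.
apply: num_radical_binary => a b c.
by rewrite radical_vec3 !mulr0 !mul0r !addr0 !add0r eqxx !mul1r andbT andbC.
Qed.

Lemma num_radical_aniso l : l != 0 -> num_radical (qform 1 0 0 (- l) 0 0) = q.
Proof.
move=> l0; apply: num_radical_binary => a b c.
rewrite radical_vec3 !mulr0 !mul0r !addr0 !add0r eqxx mulr1 andbT.
by rewrite -mulrA !two_mul_eq0 mulf_eq0 oppr_eq0 (negPf l0).
Qed.

Lemma num_radical_conic : num_radical (qform 1 0 0 0 (- 1) 0) = 1%N.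
Proof.
rewrite /num_radical -[RHS](cards1 (0 : 'rV[F]_3)); apply: eq_card => v; rewrite !inE.
rewrite -{1}[v]vec3_eta radical_vec3 !mulr0 !mul0r !addr0 !add0r mulr1.
rewrite two_mul_eq0 !mulN1r !oppr_eq0.
apply/and3P/eqP=> [[/eqP v0 /eqP v2 /eqP v1] | ->]; last by rewrite !mxE.
rewrite -[v]vec3_eta v0 v1 v2; apply/rowP=> i; rewrite !mxE.
by case: i; do 3?[case=> [|] //=].
Qed.

Lemma lprod_eq0 L M : lprod L M = 0 -> L = 0 \/ M = 0.
Proof.
rewrite -[L]vec3_eta -[M]vec3_eta.
move: (L 0 (inord 0)) (L 0 (inord 1)) (L 0 (inord 2)) => a b c.
move: (M 0 (inord 0)) (M 0 (inord 1)) (M 0 (inord 2)) => d e f.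
have -> : (0 : 'rV[F]_6) = qform 0 0 0 0 0 0.
  by rewrite -[LHS]qform_eta !mxE.
have z3 : (0 : 'rV[F]_3) = vec3 0 0 0 by rewrite -[LHS]vec3_eta !mxE.
rewrite lprod_vec3 => /qform_inj[[ad abd acd] [be bce cf]].
have [a0|a0] := eqVneq a 0; last first.
  have d0 : d = 0 by apply: (mulfI a0); rewrite ad mulr0.
  move: abd acd; rewrite d0 !mulr0 !addr0 => /eqP + /eqP.
  by rewrite !mulf_eq0 (negPf a0) => /eqP-> /eqP->; right.
have [b0|b0] := eqVneq b 0; last first.
  have e0 : e = 0 by apply: (mulfI b0); rewrite be mulr0.
  move: abd bce; rewrite a0 e0 !mulr0 add0r addr0 => /eqP + /eqP.
  by rewrite !mulf_eq0 (negPf b0) => /eqP-> /eqP->; right.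
have [c0|c0] := eqVneq c 0; first by left; rewrite a0 b0 c0.
move: acd bce cf; rewrite a0 b0 !mul0r !add0r => /eqP + /eqP + /eqP.
by rewrite !mulf_eq0 (negPf c0) => /eqP-> /eqP-> /eqP->; right.
Qed.

Lemma num_products0 : num_products 0 = (q ^ 3 + (q ^ 3).-1)%N.
Proof.
rewrite /num_products (_ : [set z | _] =
  setX setT [set 0] :|: setX [set 0] [set~ 0]).
  rewrite cardsU disjoint_setI0 ?cards0 ?subn0.
    by rewrite !cardsX !cards1 cardsC1 cardsT card_mx !(muln1, mul1n).
  rewrite -setI_eq0 -subset0; apply/subsetP=> -[L M]; rewrite !inE /=.
  by case: (M == 0); rewrite ?andbF ?andbT.
apply/setP=> -[L M]; rewrite !inE /=.
apply/eqP/orP=> [/lprod_eq0 LM0 | [/eqP-> | /andP[/eqP-> _]]].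
- have [M0|M0] := eqVneq M 0; [by left | right].
  by case: LM0 => [->|M1]; [rewrite eqxx | rewrite M1 eqxx in M0].
- by rewrite -(scale0r (0 : 'rV[F]_3)) lprodZr scale0r.
- by rewrite lprodC -(scale0r (0 : 'rV[F]_3)) lprodZr scale0r.
Qed.

(** The factors of $u^2$ are $cu$ and $c^{-1}u$. *)
Lemma num_products_u2 : num_products (qform 1 0 0 0 0 0) = q.-1.
Proof.
pose h c := (vec3 c 0 0, vec3 c^-1 0 0).
rewrite /num_products -card_nonzero -(card_imset _ (_ : injective h)); last first.
  by move=> c c' [/vec3_inj[->]].
apply: eq_card => -[L M]; rewrite !inE /=; apply/eqP/imsetP=> [|[c + [-> ->]]]; last first.
  by rewrite inE lprod_vec3 => /mulfV->; rewrite !(mul0r, mulr0, addr0).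
rewrite -[L]vec3_eta -[M]vec3_eta.
move: (L 0 (inord 0)) (L 0 (inord 1)) (L 0 (inord 2)) => a b c.
move: (M 0 (inord 0)) (M 0 (inord 1)) (M 0 (inord 2)) => d e f.
rewrite lprod_vec3 => /qform_inj[[ad abd acd] [be _ cf]].
have a0 : a != 0 by apply: contraNneq (oner_neq0 F) => a0; rewrite -ad a0 mul0r.
have d0 : d != 0 by apply: contraNneq (oner_neq0 F) => d0; rewrite -ad d0 mulr0.
exists a; rewrite ?inE // /h.
have -> : a^-1 = d by rewrite -[LHS]mulr1 -ad mulKf.
have b0 : b = 0.
  move/eqP: be; rewrite mulf_eq0 => /orP[/eqP-> //|/eqP e0].
  by move/eqP: abd; rewrite e0 mulr0 add0r mulf_eq0 (negPf d0) orbF => /eqP.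
have c0 : c = 0.
  move/eqP: cf; rewrite mulf_eq0 => /orP[/eqP-> //|/eqP f0].
  by move/eqP: acd; rewrite f0 mulr0 add0r mulf_eq0 (negPf d0) orbF => /eqP.
move: abd acd; rewrite b0 c0 !mul0r !addr0 => /eqP + /eqP.
by rewrite !mulf_eq0 (negPf a0) => /eqP-> /eqP->.
Qed.

(** The factors of $uv$ are $cu$ and $c^{-1}v$, in either order. *)
Lemma num_products_uv : num_products (qform 0 1 0 0 0 0) = (2 * q.-1)%N.
Proof.
pose h c := (vec3 c 0 0, vec3 0 c^-1 0); pose h' c := (vec3 0 c 0, vec3 c^-1 0 0).
have h_inj : injective h by move=> c c' [/vec3_inj[->]].
have h'_inj : injective h' by move=> c c' [/vec3_inj[_ ->]].
pose N := [set t : F | t != 0].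
rewrite /num_products (_ : [set z | _] = h @: N :|: h' @: N).
  rewrite cardsU disjoint_setI0 ?cards0 ?subn0.
    by rewrite !card_imset // card_nonzero addnn -mul2n.
  rewrite -setI_eq0 -subset0; apply/subsetP=> z; rewrite inE => /andP[].
  case/imsetP=> c; rewrite inE => c0 -> /imsetP[c' _ [/vec3_inj[cE _ _] _]].
  by rewrite cE eqxx in c0.
apply/setP=> -[L M]; rewrite !inE /=.
apply/eqP/orP=> [|[/imsetP[c c0 [-> ->]]|/imsetP[c c0 [-> ->]]]]; last first.
- rewrite inE in c0.
  by rewrite lprod_vec3 mulfV // !(mul0r, mulr0, addr0, add0r).
- rewrite inE in c0.
  by rewrite lprod_vec3 mulfV // !(mul0r, mulr0, addr0, add0r).
rewrite -[L]vec3_eta -[M]vec3_eta.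
move: (L 0 (inord 0)) (L 0 (inord 1)) (L 0 (inord 2)) => a b c.
move: (M 0 (inord 0)) (M 0 (inord 1)) (M 0 (inord 2)) => d e f.
rewrite lprod_vec3 => /qform_inj[[ad abd acd] [be bce cf]].
have n1 := oner_neq0 F.
have [a0|a0] := eqVneq a 0; [right|left].
  move: abd acd; rewrite a0 !mul0r !add0r => bd /eqP.
  have b0 : b != 0 by apply: contraNneq n1 => b0; rewrite -bd b0 mul0r.
  have d0 : d != 0 by apply: contraNneq n1 => d0; rewrite -bd d0 mulr0.
  rewrite mulf_eq0 (negPf d0) orbF => /eqP c0.
  have e0 : e = 0 by apply: (mulfI b0); rewrite be mulr0.
  have f0 : f = 0 by apply: (mulfI b0); rewrite mulr0 -bce c0 mul0r addr0.
  apply/imsetP; exists b; rewrite ?inE // /h' c0 e0 f0.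
  by have -> : d = b^-1 by rewrite -[RHS]mulr1 -bd mulKf.
have d0 : d = 0 by apply: (mulfI a0); rewrite ad mulr0.
move: abd acd; rewrite d0 !mulr0 !addr0 => ae /eqP.
have e0 : e != 0 by apply: contraNneq n1 => e0; rewrite -ae e0 mulr0.
rewrite mulf_eq0 (negPf a0) => /eqP f0.
have b0 : b = 0 by apply: (mulIf e0); rewrite be mul0r.
have c0 : c = 0 by apply: (mulIf e0); rewrite mul0r -bce f0 mulr0 add0r.
apply/imsetP; exists a; rewrite ?inE // /h b0 c0 f0.
by have -> : e = a^-1 by rewrite -[RHS]mulr1 -ae mulKf.
Qed.

Lemma num_products_eq0 x : (forall L M, lprod L M <> x) -> num_products x = 0%N.
Proof.
by move=> nx; apply: eq_card0 => -[L M]; rewrite !inE; apply/eqP/nx.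
Qed.

(** If $(au + bv + \dots)(du + ev + \dots)$ has the coefficients of
    $u^2 - lv^2$, then $l = (bd)^2$. *)
Lemma num_products_aniso l : l \notin squares F ->
  num_products (qform 1 0 0 (- l) 0 0) = 0%N.
Proof.
move=> nl; apply: num_products_eq0 => L M; rewrite -[L]vec3_eta -[M]vec3_eta.
rewrite lprod_vec3 => /qform_inj[[ad abd _] [be _ _]].
move: (L 0 (inord 0)) (L 0 (inord 1)) (M 0 (inord 0)) (M 0 (inord 1)) ad abd be.
move=> a b d e ad abd be.
case/negP: nl; apply/imsetP; exists (b * d) => //.
transitivity (- (a * d) * (b * e)); first by rewrite be ad; ring.
transitivity ((b * d) ^+ 2 - (a * e + b * d) * (b * d)); first by ring.
by rewrite abd mul0r subr0.
Qed.

Lemma num_products_conic : num_products (qform 1 0 0 0 (- 1) 0) = 0%N.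
Proof.
apply: num_products_eq0 => L M; rewrite -[L]vec3_eta -[M]vec3_eta.
move: (L 0 (inord 0)) (L 0 (inord 1)) (L 0 (inord 2)) => a b c.
move: (M 0 (inord 0)) (M 0 (inord 1)) (M 0 (inord 2)) => d e f.
rewrite lprod_vec3 => /qform_inj[[ad abd acd] [be bce cf]].
have n1 := oner_neq0 F.
have a0 : a != 0 by apply: contraNneq n1 => a0; rewrite -ad a0 mul0r.
have d0 : d != 0 by apply: contraNneq n1 => d0; rewrite -ad d0 mulr0.
have [b0 e0] : b = 0 /\ e = 0.
  move/eqP: be; rewrite mulf_eq0 => /orP[] /eqP z0; move/eqP: abd.
    by rewrite z0 mul0r addr0 mulf_eq0 (negPf a0) => /eqP.
  by rewrite z0 mulr0 add0r mulf_eq0 (negPf d0) orbF => /eqP.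
by case/negP: n1; rewrite -oppr_eq0 -bce b0 e0 mul0r mulr0 addr0.
Qed.

Lemma num_squares0 : num_squares 0 = (q ^ 3 + q.-1)%N.
Proof.
rewrite /num_squares (_ : [set z | _] =
  setX [set 0] setT :|: setX [set~ 0] [set 0]).
  rewrite cardsU disjoint_setI0 ?cards0 ?subn0.
    by rewrite !cardsX !cards1 cardsC1 cardsT card_mx !(muln1, mul1n).
  rewrite -setI_eq0 -subset0; apply/subsetP=> -[t L]; rewrite !inE /=.
  by case: (t == 0).
apply/setP=> -[t L]; rewrite !inE /=.
apply/eqP/orP=> [|[/andP[/eqP-> _] | /andP[_ /eqP->]]]; last first.
- by rewrite -lprodZr scaler0 -(scale0r (0 : 'rV[F]_3)) lprodZr scale0r.
- by rewrite scale0r.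
move/eqP; rewrite scaler_eq0; have [t0|t0] := eqVneq t 0; first by left.
by move=> /eqP/lprod_eq0[->|->]; right; rewrite eqxx.
Qed.

Lemma scale_lprod_sq t a b c : t *: lprod (vec3 a b c) (vec3 a b c) =
  qform (t * a ^+ 2) (t * (2%:R * (a * b))) (t * (2%:R * (a * c)))
        (t * b ^+ 2) (t * (2%:R * (b * c))) (t * c ^+ 2).
Proof.
apply: qeval_inj => v; rewrite -lprodZr.
have -> : t *: vec3 a b c = vec3 (t * a) (t * b) (t * c).
  by rewrite -[LHS]vec3_eta !mxE !inordK.
by rewrite lprod_vec3 -[v]vec3_eta !qeval_vec3; ring.
Qed.

Lemma num_squares_u2 : num_squares (qform 1 0 0 0 0 0) = q.-1.
Proof.
pose h c := (c ^- 2, vec3 c 0 0).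
rewrite /num_squares -card_nonzero -(card_imset _ (_ : injective h)); last first.
  by move=> c c' [_ /vec3_inj[->]].
apply: eq_card => -[t L]; rewrite !inE /=.
apply/eqP/imsetP=> [|[c + [-> ->]]]; last first.
  rewrite inE scale_lprod_sq => c0.
  by rewrite mulVf ?expf_neq0 // expr0n !(mul0r, mulr0).
rewrite -[L]vec3_eta; move: (L 0 (inord 0)) (L 0 (inord 1)) (L 0 (inord 2)) => a b c.
rewrite scale_lprod_sq => /qform_inj[[ta _ _] [tb _ tc]].
have n1 := oner_neq0 F.
have t0 : t != 0 by apply: contraNneq n1 => t0; rewrite -ta t0 mul0r.
have a0 : a != 0 by apply: contraNneq n1 => a0; rewrite -ta a0 expr0n mulr0.
exists a; rewrite ?inE // /h.
have -> : t = a ^- 2 by apply: (mulIf (expf_neq0 2 a0)); rewrite ta mulVf ?expf_neq0.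
move: tb tc => /eqP + /eqP.
by rewrite !mulf_eq0 !(negPf t0) !orbb => /eqP-> /eqP->.
Qed.

Lemma num_squares_eq0 x :
  (forall t a b c, t *: lprod (vec3 a b c) (vec3 a b c) <> x) -> num_squares x = 0%N.
Proof.
move=> nx; apply: eq_card0 => -[t L]; rewrite !inE /= -[L]vec3_eta; exact/eqP/nx.
Qed.

Lemma num_squares_uv : num_squares (qform 0 1 0 0 0 0) = 0%N.
Proof.
apply: num_squares_eq0 => t a b c; rewrite scale_lprod_sq.
case/qform_inj=> [[/eqP ta tab _] _].
case/negP: (oner_neq0 F); rewrite -tab; move: ta; rewrite mulf_eq0 sqrf_eq0.
by case/orP=> /eqP->; rewrite !(mul0r, mulr0).
Qed.

Lemma num_squares_aniso l : l != 0 -> num_squares (qform 1 0 0 (- l) 0 0) = 0%N.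
Proof.
move=> l0; apply: num_squares_eq0 => t a b c; rewrite scale_lprod_sq.
case/qform_inj=> [[ta /eqP tab _] [tb _ _]].
have n1 := oner_neq0 F.
have t0 : t != 0 by apply: contraNneq n1 => t0; rewrite -ta t0 mul0r.
have a0 : a != 0 by apply: contraNneq n1 => a0; rewrite -ta a0 expr0n mulr0.
move: tab; rewrite mulf_eq0 (negPf t0) two_mul_eq0 mulf_eq0 (negPf a0) => /eqP b0.
by case/negP: l0; rewrite -oppr_eq0 -tb b0 expr0n mulr0.
Qed.

Lemma num_squares_conic : num_squares (qform 1 0 0 0 (- 1) 0) = 0%N.
Proof.
apply: num_squares_eq0 => t a b c; rewrite scale_lprod_sq.
case/qform_inj=> [_ [/eqP tb tbc _]].
case/negP: (oner_neq0 F); rewrite -oppr_eq0 -tbc; move: tb; rewrite mulf_eq0 sqrf_eq0.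
by case/orP=> /eqP->; rewrite !(mul0r, mulr0).
Qed.

End Invariants.

(** * Disjointness of the orbits *)

Section OrbitValues.
Variable F : finFieldType.
Hypothesis two_neq0 : 2%:R != 0 :> F.
Variable l : F.
Hypothesis l_nonsquare : l \notin squares F.
Local Notation q := #|F|.

Lemma nonsquare_neq0 : l != 0.
Proof.
by apply: contraNneq l_nonsquare => ->; apply/imsetP; exists 0; rewrite ?expr0n.
Qed.

Lemma num_zeros_rep (i : 'I_5) : num_zeros (orbit_rep l i) =
  nth 0%N [:: q ^ 3; q ^ 2; q * (q + q.-1); q; q ^ 2]%N i.
Proof.
case: i => [[|[|[|[|[|]]]]] //= lt_i5]; rewrite /orbit_rep /=.
- exact: num_zeros0.
- exact: num_zeros_u2.
- exact: num_zeros_uv.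
- exact: num_zeros_aniso.
- exact: num_zeros_conic.
Qed.

Lemma num_radical_rep (i : 'I_5) : num_radical (orbit_rep l i) =
  nth 0%N [:: q ^ 3; q ^ 2; q; q; 1]%N i.
Proof.
case: i => [[|[|[|[|[|]]]]] //= lt_i5]; rewrite /orbit_rep /=.
- exact: num_radical0.
- exact: num_radical_u2.
- exact: num_radical_uv.
- by apply: num_radical_aniso => //; apply: nonsquare_neq0.
- exact: num_radical_conic.
Qed.

Lemma num_products_rep (i : 'I_5) : num_products (orbit_rep l i) =
  nth 0%N [:: q ^ 3 + (q ^ 3).-1; q.-1; 2 * q.-1; 0; 0]%N i.
Proof.
case: i => [[|[|[|[|[|]]]]] //= lt_i5]; rewrite /orbit_rep /=.
- exact: num_products0.
- exact: num_products_u2.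
- exact: num_products_uv.
- exact: num_products_aniso.
- exact: num_products_conic.
Qed.

Lemma num_squares_rep (i : 'I_5) : num_squares (orbit_rep l i) =
  nth 0%N [:: q ^ 3 + q.-1; q.-1; 0; 0; 0]%N i.
Proof.
case: i => [[|[|[|[|[|]]]]] //= lt_i5]; rewrite /orbit_rep /=.
- exact: num_squares0.
- exact: num_squares_u2.
- exact: num_squares_uv.
- by apply: num_squares_aniso => //; apply: nonsquare_neq0.
- exact: num_squares_conic.
Qed.

(** The radical separates the representatives up to the third and the fourth,
    which the number of zeros distinguishes. *)
Lemma qorbit_index_inj x (i j : 'I_5) :
  x \in qorbit (orbit_rep l i) -> x \in qorbit (orbit_rep l j) -> i = j.
Proof.
move=> xi xj.
have q_gt1 : (1 < q)%N by apply: finNzRing_gt1.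
have : num_radical (orbit_rep l i) = num_radical (orbit_rep l j).
  by rewrite -(invariant_qorbit (num_radical_invariant two_neq0) xi)
             -(invariant_qorbit (num_radical_invariant two_neq0) xj).
have : num_zeros (orbit_rep l i) = num_zeros (orbit_rep l j).
  by rewrite -(invariant_qorbit (@num_zeros_invariant _) xi)
             -(invariant_qorbit (@num_zeros_invariant _) xj).
pose e := nth 0%N [:: 3; 2; 1; 1; 0]%N.
have radE k : num_radical (orbit_rep l k) = (q ^ e k)%N.
  by rewrite num_radical_rep; case: k => [[|[|[|[|[|]]]]] //= _]; rewrite /e /= ?expn1.
rewrite !num_zeros_rep !radE => zE /(expnI q_gt1) eE; apply: val_inj.
have uv_aniso : (q * (q + q.-1))%N != q.
  rewrite -[X in _ != X]muln1 eqn_pmul2l ?(ltnW q_gt1) //.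
  by move: q_gt1; case: (q) => [|[|n]].
(* The exponents agree at two distinct indices only for the third and fourth. *)
case: i j eE zE {xi xj} => [[|[|[|[|[|]]]]] // lt_i] [[|[|[|[|[|]]]]] // lt_j] // _ zE.
  by case/eqP: uv_aniso.
by case/eqP: uv_aniso.
Qed.

Lemma sum_orbits (A : nmodType) (phi : 'rV[F]_6 -> A) :
  \sum_x phi x = \sum_(i < 5) \sum_(x in qorbit (orbit_rep l i)) phi x.
Proof.
under [RHS]eq_bigr do rewrite big_mkcond.
rewrite exchange_big; apply: eq_bigr => x _.
have [i xi] := qorbit_exhaust two_neq0 l_nonsquare x.
rewrite (bigD1 i) //= xi big1 ?addr0 // => j ji.
by case: ifP => // xj; rewrite (qorbit_index_inj xi xj) eqxx in ji.
Qed.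

End OrbitValues.

(** * Fourier transforms of the counting functions *)

Section Transforms.
Variables (R : realType) (F : finFieldType) (p : nat).
Hypothesis charFp : p \in [pchar F].
Hypothesis two_neq0 : 2%:R != 0 :> F.
Local Notation psi := (addchar R charFp).
Local Notation q := (#|F|%:R : R[i]).
Implicit Types (x y : 'rV[F]_6) (L M : 'rV[F]_3).

(** The normalization $q^{-6}$ is left out, so that the transforms of the
    counts below are again counts, up to a power of q. *)
Definition ftransform (f : 'rV[F]_6 -> nat) y : R[i] :=
  \sum_x (f x)%:R * psi (qbil x y).

Lemma sum_fiber (T : finType) (h : T -> 'rV[F]_6) (phi : 'rV[F]_6 -> R[i]) :
  \sum_x #|[set z | h z == x]|%:R * phi x = \sum_z phi (h z).
Proof.
rewrite (partition_big h predT) //=; apply: eq_bigr => x _.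
under eq_bigr => z /eqP-> do [].
rewrite sumr_const -[RHS]mulr_natl; congr (_ * _); congr _%:R.
by apply: eq_card => z; rewrite inE.
Qed.

Lemma sum_count (T : finType) (P : pred T) (c : R[i]) :
  \sum_z (if P z then c else 0) = c * #|[set z | P z]|%:R.
Proof.
by rewrite -big_mkcond /= sumr_const mulr_natr cardsE.
Qed.

Lemma ftransform_squares y : ftransform (@num_squares F) y = q * (num_zeros y)%:R.
Proof.
rewrite /ftransform /num_squares sum_fiber.
rewrite -(pair_bigA _ (fun t L => psi (qbil (t *: lprod L L) y))) exchange_big /=.
rewrite -sum_count; apply: eq_bigr => L _.
under eq_bigr do rewrite qbilZl qbil_lprod_sq //.
rewrite (@addchar_sum _ _ _ _ F^o (fun t => t * qeval y L)) //; first last.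
- by move=> a b; rewrite -mulrA.
- by move=> a b; rewrite mulrDl.
congr (if _ then _ else _); apply/forallP/eqP => [/(_ 1)/eqP | -> t].
  by rewrite mul1r.
by rewrite mulr0.
Qed.

Lemma sum_psi_lprod y :
  \sum_(z : 'rV[F]_3 * 'rV[F]_3) psi (qbil (lprod z.1 z.2) y) =
    q ^+ 3 * (num_radical y)%:R.
Proof.
rewrite -(pair_bigA _ (fun L M => psi (qbil (lprod L M) y))) /=.
rewrite -sum_count; apply: eq_bigr => L _.
rewrite (@addchar_sum _ _ _ _ _ (fun M => qbil (lprod L M) y)) //; first last.
- by move=> a M; rewrite lprodZr qbilZl.
- by move=> M M'; rewrite lprodDr qbilDl.
by rewrite card_mx natrX.
Qed.

Lemma ftransform_products y :
  ftransform (@num_products F) y = q ^+ 3 * (num_radical y)%:R.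
Proof. by rewrite /ftransform /num_products sum_fiber sum_psi_lprod. Qed.

(** The bilinear form is nondegenerate because $[L^2, y] = y(L)$. *)
Lemma sum_psi_qbil y : \sum_x psi (qbil x y) = if y == 0 then q ^+ 6 else 0.
Proof.
rewrite (@addchar_sum _ _ _ _ _ (fun x => qbil x y)); first last.
- by move=> a x; rewrite qbilZl.
- by move=> x x'; rewrite qbilDl.
rewrite card_mx natrX; congr (if _ then _ else _); apply/forallP/eqP=> [y0|-> x].
  apply/eqP/qeval_eq0P => L; rewrite -qbil_lprod_sq //; exact/eqP/y0.
by apply/eqP; rewrite /qbil !mxE; ring.
Qed.

Lemma card_neq0 : q != 0.
Proof. by rewrite pnatr_eq0 -lt0n; apply/card_gt0P; exists 0. Qed.

(** The cardinality of the radical is itself a character sum over pairs of linear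
    forms; exchanging the sums leaves the pairs with $LM = -y$. *)
Lemma ftransform_radical y :
  ftransform (@num_radical F) y = q ^+ 3 * (num_products y)%:R.
Proof.
apply: (mulfI (expf_neq0 3 card_neq0)); rewrite mulrA -exprD -num_productsN.
rewrite /ftransform mulr_sumr.
under eq_bigr => x _ do rewrite mulrA -sum_psi_lprod mulr_suml.
rewrite exchange_big /= /num_products -sum_count; apply: eq_bigr => z _.
under eq_bigr => x _ do rewrite -addcharD qbilC -qbilDr.
by rewrite sum_psi_qbil addr_eq0.
Qed.

End Transforms.

(** * Solution of the linear system *)

Definition orbit_sum_table (K : fieldType) (c : K) : seq (seq K) := [::
    [:: 1; c ^+ 3 - 1; c * (c + 1) * (c ^+ 3 - 1) / 2%:R;
        c * (c - 1) * (c ^+ 3 - 1) / 2%:R; c ^+ 2 * (c - 1) * (c ^+ 3 - 1)];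
    [:: 1; - 1; c * (c + 1) * (c ^+ 2 - 1) / 2%:R;
        - (c * (c - 1) * (c ^+ 2 + 1) / 2%:R); - (c ^+ 2 * (c - 1))];
    [:: 1; c ^+ 2 - 1; c * (c ^+ 2 - 2%:R * c - 1) / 2%:R;
        c * (c - 1) ^+ 2 / 2%:R; - (c ^+ 2 * (c - 1))];
    [:: 1; - c ^+ 2 - 1; c * (c ^+ 2 - 1) / 2%:R;
        c * (c ^+ 2 + 1) / 2%:R; - (c ^+ 2 * (c - 1))];
    [:: 1; - 1; - (c * (c + 1) / 2%:R); - (c * (c - 1) / 2%:R); c ^+ 2]].

(** The first two equations give s1 and s2 in turn, and the difference of the
    last two eliminates s4 and gives s3. *)
Lemma orbit_system_solution (K : fieldType) (c N D P T s1 s2 s3 s4 : K) :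
    c - 1 != 0 -> 2%:R != 0 :> K ->
    c ^+ 3 + (c - 1) + (c - 1) * s1 = c * N ->
    c ^+ 3 + (c ^+ 3 - 1) + (c - 1) * s1 + 2%:R * (c - 1) * s2 = c ^+ 3 * D ->
    c ^+ 3 + c ^+ 2 * s1 + c * s2 + c * s3 + s4 = c ^+ 3 * P ->
    1 + s1 + s2 + s3 + s4 = T ->
  [/\ s1 = (c * N - (c ^+ 3 + c - 1)) / (c - 1),
      s2 = (c ^+ 3 * D - c ^+ 3 - c * N + c) / (2%:R * (c - 1)),
      s3 = (c ^+ 3 * P - T - (c ^+ 3 - 1) - (c + 1) * (c * N - (c ^+ 3 + c - 1)))
             / (c - 1) - (c ^+ 3 * D - c ^+ 3 - c * N + c) / (2%:R * (c - 1)) &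
      s4 = T - 1 - s1 - s2 - s3].
Proof.
by move=> c1 two <- <- <- <-; split; last (by ring); field; rewrite ?c1 ?two.
Qed.

Lemma orbit_system_table (K : fieldType) (c s1 s2 s3 s4 : K) (i j : 'I_5) :
    c - 1 != 0 -> 2%:R != 0 :> K ->
    c ^+ 3 + (c - 1) + (c - 1) * s1 =
      c * [:: c ^+ 3; c ^+ 2; c * (c + (c - 1)); c; c ^+ 2]`_i ->
    c ^+ 3 + (c ^+ 3 - 1) + (c - 1) * s1 + 2%:R * (c - 1) * s2 =
      c ^+ 3 * [:: c ^+ 3; c ^+ 2; c; c; 1]`_i ->
    c ^+ 3 + c ^+ 2 * s1 + c * s2 + c * s3 + s4 =
      c ^+ 3 * [:: c ^+ 3 + (c ^+ 3 - 1); c - 1; 2%:R * (c - 1); 0; 0]`_i ->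
    1 + s1 + s2 + s3 + s4 = [:: c ^+ 6; 0; 0; 0; 0]`_i ->
  [:: 1; s1; s2; s3; s4]`_j = (nth [::] (orbit_sum_table c) i)`_j.
Proof.
move=> c1 two sqE prE raE onE.
have [E1 E2 E3 E4] := orbit_system_solution c1 two sqE prE raE onE.
rewrite E4 E3 E2 E1 /orbit_sum_table; clear -c1 two.
by case: i j => [[|[|[|[|[|]]]]] // ?] [[|[|[|[|[|]]]]] // ?] //=;
  field; rewrite ?c1 ?two.
Qed.

Section OrbitTransforms.
Variables (R : realType) (F : finFieldType) (p : nat).
Hypothesis charFp : p \in [pchar F].
Hypothesis two_neq0 : 2%:R != 0 :> F.
Variable l : F.
Hypothesis l_nonsquare : l \notin squares F.
Local Notation psi := (addchar R charFp).
Local Notation q := (#|F|%:R : R[i]).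
Implicit Types (x y : 'rV[F]_6).

Definition orbit_sum (j : 'I_5) y : R[i] :=
  \sum_(x in qorbit (orbit_rep l j)) psi (qbil x y).

Lemma fourier_orbit_ind j y :
  fourier charFp (orbit_ind R l j) y = q ^- 6 * orbit_sum j y.
Proof.
rewrite /fourier /orbit_sum [in RHS]big_mkcond; congr (_ * _); apply: eq_bigr => x _.
by rewrite /orbit_ind; case: ifP => _; rewrite ?mul1r ?mul0r.
Qed.

Lemma ftransform_orbits f y : qinvariant f ->
  ftransform R charFp f y = \sum_(j < 5) (f (orbit_rep l j))%:R * orbit_sum j y.
Proof.
move=> fI; rewrite /ftransform (sum_orbits two_neq0 l_nonsquare).
apply: eq_bigr => j _; rewrite /orbit_sum mulr_sumr; apply: eq_bigr => x xj.
by rewrite (invariant_qorbit fI xj).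
Qed.

Lemma orbit_sum0 y : orbit_sum ord0 y = 1.
Proof.
rewrite /orbit_sum /orbit_rep /= qorbit0 big_set1.
rewrite (_ : qbil 0 y = 0) ?addchar0 // /qbil !mxE; ring.
Qed.

Lemma sum_ord5 (A : nmodType) (G : 'I_5 -> A) : \sum_(j < 5) G j =
  G (inord 0) + G (inord 1) + G (inord 2) + G (inord 3) + G (inord 4).
Proof.
rewrite !big_ord_recl big_ord0 addr0 !addrA.
by congr (G _ + G _ + G _ + G _ + G _); apply: val_inj; rewrite /= inordK.
Qed.

Lemma orbit_sumE (i j : 'I_5) y : y \in qorbit (orbit_rep l i) ->
  orbit_sum j y = (nth [::] (orbit_sum_table q) i)`_j.
Proof.
move=> yi.
have q_gt0 : (0 < #|F|)%N by apply/card_gt0P; exists 0.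
have q1 : q - 1 != 0.
  by rewrite subr_eq0 pnatr_eq1; have := finNzRing_gt1 F; case: #|F| => [|[]].
have two : 2%:R != 0 :> R[i] by rewrite pnatr_eq0.
have pred_q : #|F|.-1%:R = q - 1 by rewrite -subn1 natrB.
have pred_q3 : (#|F| ^ 3).-1%:R = q ^+ 3 - 1.
  by rewrite -subn1 natrB ?expn_gt0 ?q_gt0 // natrX.
have sqE := ftransform_squares R charFp two_neq0 y.
have prE := ftransform_products R charFp y.
have raE := ftransform_radical R charFp two_neq0 y.
have onE := sum_psi_qbil R charFp two_neq0 y.
have y0E : (y == 0) = (i == inord 0).
  have yE : (y == 0) = (y \in qorbit (orbit_rep l (inord 0))).
    by rewrite /orbit_rep inordK // qorbit0 inE.
  rewrite yE; apply/idP/eqP=> [|<- //]; exact: qorbit_index_inj yi.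
rewrite (sum_orbits two_neq0 l_nonsquare) sum_ord5 y0E in onE.
rewrite ftransform_orbits in sqE; last exact: num_squares_invariant.
rewrite ftransform_orbits in prE; last exact: num_products_invariant.
rewrite ftransform_orbits in raE; last exact: num_radical_invariant.
rewrite (invariant_qorbit (@num_zeros_invariant _) yi) in sqE.
rewrite (invariant_qorbit (num_radical_invariant two_neq0) yi) in prE.
rewrite (invariant_qorbit (@num_products_invariant _) yi) in raE.
rewrite num_zeros_rep // sum_ord5 !num_squares_rep // !inordK //= in sqE.
rewrite num_radical_rep // sum_ord5 !num_products_rep // !inordK //= in prE.
rewrite num_products_rep // sum_ord5 !num_radical_rep // !inordK //= in raE.
rewrite -!/(orbit_sum _ _) in onE.
have s0 : orbit_sum (inord 0) y = 1.
  by rewrite -(orbit_sum0 y); congr orbit_sum; apply: val_inj; rewrite /= inordK.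
have -> : orbit_sum j y = [:: 1; orbit_sum (inord 1) y; orbit_sum (inord 2) y;
    orbit_sum (inord 3) y; orbit_sum (inord 4) y]`_j.
  by rewrite -[j in LHS]inord_val; case: (j) => [[|[|[|[|[|]]]]]].
apply: orbit_system_table => //.
- transitivity (q * (nth 0%N [:: #|F| ^ 3; #|F| ^ 2; #|F| * (#|F| + #|F|.-1);
                               #|F|; #|F| ^ 2]%N i)%:R).
    by rewrite -sqE s0 !(natrD, natrX, pred_q, mulr1, mul0r, addr0).
  by case: (i) => [[|[|[|[|[|]]]]] // ?]; rewrite /= ?(natrM, natrD, natrX, pred_q).
- transitivity (q ^+ 3 * (nth 0%N [:: #|F| ^ 3; #|F| ^ 2; #|F|; #|F|; 1]%N i)%:R).
    by rewrite -prE s0 !(natrM, natrD, natrX, pred_q3, pred_q, mulr1, mul0r, addr0).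
  by case: (i) => [[|[|[|[|[|]]]]] // ?]; rewrite /= ?natrX.
- transitivity (q ^+ 3 * (nth 0%N [:: #|F| ^ 3 + (#|F| ^ 3).-1; #|F|.-1;
                                    2 * #|F|.-1; 0; 0]%N i)%:R).
    by rewrite -raE s0 !(natrX, mulr1, mul1r).
  case: (i) => [[|[|[|[|[|]]]]] // ?];
    by rewrite /= ?(natrM, natrD, natrX, pred_q, pred_q3).
- rewrite s0 in onE; rewrite onE -val_eqE /= inordK //.
  by case: (i) => [[|[|[|[|[|]]]]] // ?].
Qed.

Lemma orbit_ind_sum (c : 'I_5 -> R[i]) i y : y \in qorbit (orbit_rep l i) ->
  \sum_(k < 5) c k * orbit_ind R l k y = c i.
Proof.
move=> yi; rewrite (bigD1 i) //= /orbit_ind yi mulr1 big1 ?addr0 // => k ki.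
case: (boolP (y \in _)) => [yk|]; last by rewrite mulr0.
by rewrite (qorbit_index_inj two_neq0 l_nonsquare yi yk) eqxx in ki.
Qed.

End OrbitTransforms.

Theorem theorem18 (R : realType) (F : finFieldType) (p : nat)
    (charFp : p \in [pchar F]) (p_neq2 : p <> 2%N)
    (l : F) (l_neq0 : l <> 0) (l_nonsquare : ~ (exists z : F, z ^+ 2 = l))
    (M : 'M[R[i]]_5) :
  let q : R[i] := #|F|%:R in
  (forall j : 'I_5,
     fourier charFp (orbit_ind R l j)
       =1 (fun x => \sum_(i < 5) M i j * orbit_ind R l i x))
  <->
  M = q ^- 6 *: \matrix_(i < 5, j < 5) (nth [::] [::
    [:: 1; q ^+ 3 - 1; q * (q + 1) * (q ^+ 3 - 1) / 2%:R;
        q * (q - 1) * (q ^+ 3 - 1) / 2%:R; q ^+ 2 * (q - 1) * (q ^+ 3 - 1)];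
    [:: 1; - 1; q * (q + 1) * (q ^+ 2 - 1) / 2%:R;
        - (q * (q - 1) * (q ^+ 2 + 1) / 2%:R); - (q ^+ 2 * (q - 1))];
    [:: 1; q ^+ 2 - 1; q * (q ^+ 2 - 2%:R * q - 1) / 2%:R;
        q * (q - 1) ^+ 2 / 2%:R; - (q ^+ 2 * (q - 1))];
    [:: 1; - q ^+ 2 - 1; q * (q ^+ 2 - 1) / 2%:R;
        q * (q ^+ 2 + 1) / 2%:R; - (q ^+ 2 * (q - 1))];
    [:: 1; - 1; - (q * (q + 1) / 2%:R); - (q * (q - 1) / 2%:R); q ^+ 2]] i)`_j.
Proof.
move=> q; rewrite -/(orbit_sum_table q).
have two_neq0 : 2%:R != 0 :> F.
  apply/eqP=> two0; apply: p_neq2.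
  have: 2%N \in [pchar F] by rewrite inE /= two0 eqxx.
  by rewrite (pcharf_eq charFp) inE => /eqP/esym.
have nl : l \notin squares F.
  by apply/imsetP=> -[z _ lE]; apply: l_nonsquare; exists z.
have fourierE i j y : y \in qorbit (orbit_rep l i) ->
    fourier charFp (orbit_ind R l j) y = q ^- 6 * (nth [::] (orbit_sum_table q) i)`_j.
  by move=> yi; rewrite fourier_orbit_ind (orbit_sumE R charFp two_neq0 nl _ yi).
split=> [ME | -> j y].
  apply/matrixP=> i j; rewrite !mxE -(fourierE i j _ (qorbit_refl _)) ME.
  by rewrite (orbit_ind_sum two_neq0 nl _ (qorbit_refl _)).
have [i yi] := qorbit_exhaust two_neq0 nl y.
by rewrite (orbit_ind_sum two_neq0 nl _ yi) (fourierE i j y yi) !mxE.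
Qed.
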